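(* Let $m,n$ be nonzero integers with $|m|\neq|n|$, and let $B(m,n)=\langle a,b : a^{-1}b^m a=b^n\rangle$ be the Baumslag–Solitar group. Then for every pair $(\phi,\psi)$ of injective endomorphisms of $B(m,n)$ the coincidence Reidemeister number $R(\phi,\psi)$ is infinite.
   Context: For groups $K,\pi$ and homomorphisms $f_1,f_2:K\to\pi$, the set of (coincidence) Reidemeister classes $R[f_1,f_2]$ is the set of equivalence classes of elements of $\pi$ under the relation $\alpha\sim f_2(\tau)\,\alpha\, f_1(\tau)^{-1}$ for $\alpha\in\pi$, $\tau\in K$. The coincidence Reidemeister number $R(f_1,f_2)$ is the cardinality of $R[f_1,f_2]$. *)

(* Defs.v *)
From HB Require Import structures.
From mathcomp Require Import all_boot all_order all_algebra.
From mathcomp Require Import boolp classical_sets cardinality.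

Set Implicit Arguments.
Unset Strict Implicit.
Unset Printing Implicit Defensive.

Local Open Scope classical_set_scope.
Local Open Scope quotient_scope.
Local Open Scope group_scope.

(* The letter (x, false) stands for the generator x, and (x, true) for x^-1. *)
Definition word (X : Type) := seq (X * bool).

Definition word_inv (X : Type) (w : word X) : word X :=
  rev [seq (l.1, ~~ l.2) | l <- w].

Definition word_exp (X : Type) (x : X) (k : int) : word X :=
  match k with
  | Posz i => nseq i (x, false)
  | Negz i => nseq i.+1 (x, true)
  end.

(* Least congruence on words that cancels adjacent inverse letters and contains
   the defining relations rel. *)
Inductive pres_eq (X : Type) (rel : word X -> word X -> Prop) :
    word X -> word X -> Prop :=
| pres_refl u : pres_eq rel u u
| pres_sym u v : pres_eq rel u v -> pres_eq rel v u
| pres_trans u v w : pres_eq rel u v -> pres_eq rel v w -> pres_eq rel u w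
| pres_cat u u' v v' :
    pres_eq rel u u' -> pres_eq rel v v' -> pres_eq rel (u ++ v) (u' ++ v')
| pres_cancel x e : pres_eq rel [:: (x, e); (x, ~~ e)] [::]
| pres_rel u v : rel u v -> pres_eq rel u v.

Section PresentedGroup.
Variables (X : choiceType) (rel : word X -> word X -> Prop).

Definition pres_eqb (u v : word X) : bool := `[< pres_eq rel u v >].

Lemma pres_eqb_refl : reflexive pres_eqb.
Proof. by move=> u; apply/asboolP; exact: pres_refl. Qed.

Lemma pres_eqb_sym : symmetric pres_eqb.
Proof. by move=> u v; apply/asboolP/asboolP; exact: pres_sym. Qed.

Lemma pres_eqb_trans : transitive pres_eqb.
Proof.
move=> v u w /asboolP uv /asboolP vw; apply/asboolP; exact: pres_trans uv vw.
Qed.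

Canonical pres_equiv :=
  EquivRel pres_eqb pres_eqb_refl pres_eqb_sym pres_eqb_trans.

Definition presented : Type := {eq_quot pres_equiv}.

HB.instance Definition _ := Choice.on presented.
HB.instance Definition _ := Quotient.on presented.

Definition pres_class (w : word X) : presented := \pi w.

Lemma pres_classP (u v : word X) :
  pres_class u = pres_class v <-> pres_eq rel u v.
Proof.
split; first by move/eqmodP => /asboolP.
by move=> uv; apply/eqmodP/asboolP.
Qed.

Lemma pres_classK (x : presented) : pres_class (repr x) = x.
Proof. exact: reprK. Qed.

Lemma pres_repr (w : word X) : pres_eq rel (repr (pres_class w)) w.
Proof. by apply/pres_classP; rewrite pres_classK. Qed.

Lemma pres_eq_invr (w : word X) : pres_eq rel (w ++ word_inv w) [::].
Proof.
elim: w => [|[x e] w IHw]; first exact: pres_refl.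
have -> : ((x, e) :: w) ++ word_inv ((x, e) :: w) =
    [:: (x, e)] ++ ((w ++ word_inv w) ++ [:: (x, ~~ e)]).
  by rewrite /word_inv /= rev_cons -cats1 catA.
apply: (@pres_trans _ _ _ ([:: (x, e)] ++ ([::] ++ [:: (x, ~~ e)]))).
  by apply: pres_cat; last (apply: pres_cat => //); exact: pres_refl.
exact: pres_cancel.
Qed.

Lemma word_invK : involutive (@word_inv X).
Proof.
move=> w; rewrite /word_inv map_rev revK -map_comp -[RHS]map_id.
by apply: eq_map => -[x e] /=; rewrite negbK.
Qed.

Lemma pres_eq_invl (w : word X) : pres_eq rel (word_inv w ++ w) [::].
Proof. by rewrite -{2}[w]word_invK; exact: pres_eq_invr. Qed.

Lemma pres_eq_inv (u v : word X) :
  pres_eq rel u v -> pres_eq rel (word_inv u) (word_inv v).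
Proof.
move=> uv; apply: (@pres_trans _ _ _ (word_inv u ++ (v ++ word_inv v))).
  rewrite -{1}[word_inv u]cats0; apply: pres_cat; first exact: pres_refl.
  exact/pres_sym/pres_eq_invr.
rewrite catA -[X in pres_eq _ _ X]cat0s; apply: pres_cat; last exact: pres_refl.
apply: pres_trans (pres_eq_invl u); apply: pres_cat; first exact: pres_refl.
exact: pres_sym.
Qed.

Definition pres_one : presented := pres_class [::].
Definition pres_mul (x y : presented) : presented :=
  pres_class (repr x ++ repr y).
Definition pres_inv (x : presented) : presented :=
  pres_class (word_inv (repr x)).

Lemma pres_mulE (u v : word X) :
  pres_mul (pres_class u) (pres_class v) = pres_class (u ++ v).
Proof. by apply/pres_classP/pres_cat; exact: pres_repr. Qed.

Lemma pres_invE (u : word X) :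
  pres_inv (pres_class u) = pres_class (word_inv u).
Proof. by apply/pres_classP/pres_eq_inv; exact: pres_repr. Qed.

Lemma pres_mulA : associative pres_mul.
Proof.
move=> x y z; rewrite -[x]pres_classK -[y]pres_classK -[z]pres_classK.
by rewrite !pres_mulE catA.
Qed.

Lemma pres_mul1 : left_id pres_one pres_mul.
Proof. by move=> x; rewrite -[x]pres_classK pres_mulE cat0s. Qed.

Lemma pres_mulr1 : right_id pres_one pres_mul.
Proof. by move=> x; rewrite -[x]pres_classK pres_mulE cats0. Qed.

Lemma pres_mulV : left_inverse pres_one pres_inv pres_mul.
Proof.
move=> x; rewrite -[x]pres_classK pres_invE pres_mulE.
exact/pres_classP/pres_eq_invl.
Qed.

Lemma pres_mulrV : right_inverse pres_one pres_inv pres_mul.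
Proof.
move=> x; rewrite -[x]pres_classK pres_invE pres_mulE.
exact/pres_classP/pres_eq_invr.
Qed.

HB.instance Definition _ := isGroup.Build presented
  pres_mulA pres_mul1 pres_mulr1 pres_mulV pres_mulrV.

Lemma pres_classM (u v : word X) :
  pres_class (u ++ v) = pres_class u * pres_class v.
Proof. by rewrite -pres_mulE. Qed.

Lemma pres_classV (u : word X) : pres_class (word_inv u) = (pres_class u)^-1.
Proof. by rewrite -pres_invE. Qed.

Definition pres_gen (x : X) : presented := pres_class [:: (x, false)].

End PresentedGroup.

Section UniversalProperty.
Variables (X : choiceType) (rel : word X -> word X -> Prop) (G : groupType).
Variable g : X -> G.

Definition letter_eval (l : X * bool) : G := if l.2 then (g l.1)^-1 else g l.1.
Definition word_eval (w : word X) : G := \prod_(l <- w) letter_eval l.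

Lemma word_eval_cat (u v : word X) :
  word_eval (u ++ v) = word_eval u * word_eval v.
Proof. exact: big_cat. Qed.

Hypothesis g_rel : forall u v, rel u v -> word_eval u = word_eval v.

Lemma pres_eq_eval (u v : word X) :
  pres_eq rel u v -> word_eval u = word_eval v.
Proof.
elim=> // {u v} [u v w _ -> _ -> //|u u' v v' _ uu' _ vv'|x e].
  by rewrite !word_eval_cat uu' vv'.
rewrite /word_eval !big_cons big_nil mulg1 /letter_eval /=.
by case: e => /=; rewrite ?mulVg ?mulgV.
Qed.

Definition pres_lift (x : presented rel) : G := word_eval (repr x).

Lemma pres_lift_class (w : word X) : pres_lift (pres_class rel w) = word_eval w.
Proof. by apply: pres_eq_eval; exact: pres_repr. Qed.

Lemma pres_lift_gen (x : X) : pres_lift (pres_gen rel x) = g x.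
Proof. by rewrite pres_lift_class /word_eval big_seq1. Qed.

Lemma pres_liftM : {morph pres_lift : x y / x * y}.
Proof.
move=> x y; rewrite -[x]pres_classK -[y]pres_classK -pres_classM.
by rewrite !pres_lift_class word_eval_cat.
Qed.

End UniversalProperty.

Definition gen_a : bool := false.
Definition gen_b : bool := true.

(* The single defining relation a^-1 b^m a = b^n. *)
Definition BS_rel (m n : int) (u v : word bool) : Prop :=
  u = word_inv [:: (gen_a, false)] ++ word_exp gen_b m ++ [:: (gen_a, false)]
  /\ v = word_exp gen_b n.

Definition BS (m n : int) : groupType := presented (BS_rel m n).

Definition expgz (G : groupType) (x : G) (k : int) : G :=
  match k with
  | Posz i => x ^+ i
  | Negz i => x ^- i.+1
  end.

Lemma pres_class_exp (X : choiceType) (rel : word X -> word X -> Prop) (x : X)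
    (k : int) :
  pres_class rel (word_exp x k) = expgz (pres_gen rel x) k.
Proof.
case: k => i /=; first by elim: i => [//|i IHi]; rewrite expgS -IHi -pres_classM.
have -> : (x, true) :: nseq i (x, true) = word_inv (nseq i.+1 (x, false)).
  by rewrite /word_inv map_nseq rev_nseq.
rewrite pres_classV; congr (_^-1).
by elim: i.+1 => [//|{}i IHi]; rewrite expgS -IHi -pres_classM.
Qed.

Lemma BS_relation (m n : int) :
  let a : BS m n := pres_gen _ gen_a in
  let b : BS m n := pres_gen _ gen_b in
  a^-1 * expgz b m * a = expgz b n.
Proof.
move=> a b; rewrite -[RHS]pres_class_exp.
have /pres_classP <- : pres_eq (BS_rel m n) (word_inv [:: (gen_a, false)] ++
    word_exp gen_b m ++ [:: (gen_a, false)]) (word_exp gen_b n).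
  by apply: pres_rel; split.
by rewrite !pres_classM pres_classV pres_class_exp mulgA.
Qed.

Section Reidemeister.
Variables (K P : groupType) (f1 f2 : UMagmaMorphism.type K P).

Definition reidemeister_rel (alpha beta : P) : Prop :=
  exists tau : K, beta = f2 tau * alpha * (f1 tau)^-1.

Definition reidemeister_class (alpha : P) : set P :=
  [set beta | reidemeister_rel alpha beta].

Definition reidemeister_classes : set (set P) := range reidemeister_class.

Lemma reidemeister_rel_refl alpha : reidemeister_rel alpha alpha.
Proof. by exists 1; rewrite !gmulf1 invg1 mulg1 mul1g. Qed.

Lemma reidemeister_rel_sym alpha beta :
  reidemeister_rel alpha beta -> reidemeister_rel beta alpha.
Proof.
move=> [t ->]; exists t^-1.
by rewrite !gmulfV invgK !mulgA mulVg mul1g -mulgA mulVg mulg1.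
Qed.

Lemma reidemeister_rel_trans alpha beta gamma :
  reidemeister_rel alpha beta -> reidemeister_rel beta gamma ->
  reidemeister_rel alpha gamma.
Proof.
by move=> [t ->] [s ->]; exists (s * t); rewrite !gmulfM invgM !mulgA.
Qed.

End Reidemeister.

(* Main.v *)
(* Let h : B(m,n) -> Z be the exponent sum of a.  An injective endomorphism phi
   preserves h.  Indeed x = phi(b) is nontrivial and x^m is conjugate to x^n.
   If x were not conjugate to a power of b, it would be conjugate to a nonempty
   cyclically reduced word y with t > 0 letters a or a^-1.  By Britton's lemma
   (read off the action on normal forms) y^k has length k t, while conjugation
   by a fixed element changes lengths by a bounded amount; applied to y^(k m^2)
   and y^(k n^2) for large k this contradicts |m| <> |n|.  So x is conjugate to
   b^j with j <> 0, and the affine action b : q |-> q + 1, a : q |-> (m/n) q on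
   the rationals gives (m/n)^h(phi(a)) = m/n, that is, h(phi(a)) = 1.
   Hence h is constant on Reidemeister classes and separates those of a^i. *)

Require Import Defs.
From HB Require Import structures.
From mathcomp Require Import all_boot all_order all_algebra.
From mathcomp Require Import boolp classical_sets cardinality.
From mathcomp Require Import zify ring.

Set Implicit Arguments.
Unset Strict Implicit.
Unset Printing Implicit Defensive.

Import Order.TTheory GRing.Theory Num.Theory.

Local Open Scope ring_scope.

(** * Integer powers in a group *)

Section IntegerPowers.
Variable G : groupType.
Implicit Types x y u : G.

Lemma expgzS x k : expgz x (k + 1) = (expgz x k * x)%g.
Proof.
case: k => [i|[|i]]; first by rewrite -PoszD addn1 /= expgSr.
  by rewrite /= mulVg.
have -> : Negz i.+1 + 1 = Negz i by lia.
by rewrite /= [in RHS]expgS invgM mulgVK.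
Qed.

(** Reduces each law of integer exponents to a one-step recurrence, without case analysis on signs;
    the downward step cancels [y]. *)
Lemma expgz_unique (f : int -> G) y :
  f 0 = 1%g -> (forall k, f (k + 1) = (f k * y)%g) -> f =1 expgz y.
Proof.
move=> f0 fS; elim=> [|n IHn|n IHn]; first by rewrite f0.
  by rewrite -addn1 PoszD fS expgzS IHn.
apply: (mulIg y); rewrite -fS -expgzS.
by have -> : - n.+1%:Z + 1 = - n%:Z by lia.
Qed.

Lemma expgzD x i j : expgz x (i + j) = (expgz x i * expgz x j)%g.
Proof.
rewrite -(@expgz_unique (fun j => (expgz x i)^-1 * expgz x (i + j))%g x _ _ j).
- by rewrite mulVKg.
- by rewrite addr0 mulVg.
- by move=> k; rewrite addrA expgzS mulgA.
Qed.

Lemma expgzM x i j : expgz x (i * j) = expgz (expgz x i) j.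
Proof.
move: j; apply: expgz_unique => [|k]; first by rewrite mulr0.
by rewrite mulrDr mulr1 expgzD.
Qed.

Lemma expgzJ x u k : (expgz x k ^ u)%g = expgz (x ^ u)%g k.
Proof.
move: k; apply: expgz_unique => [|k]; first by rewrite conj1g.
by rewrite expgzS conjMg.
Qed.

End IntegerPowers.

Lemma gmulfXz (G H : groupType) (f : UMagmaMorphism.type G H) x k :
  f (expgz x k) = expgz (f x) k.
Proof.
move: k; apply: expgz_unique => [|k]; first by rewrite gmulf1.
by rewrite expgzS gmulfM.
Qed.

(** * Actions of a presented group defined letter by letter *)

Section PresentedAction.
Variables (X : choiceType) (rel : word X -> word X -> Prop).
Variables (T : Type) (V : T -> Prop) (act : X * bool -> T -> T).
Hypothesis act_stable : forall l t, V t -> V (act l t).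
Hypothesis act_cancel :
  forall x e t, V t -> act (x, e) (act (x, ~~ e) t) = t.
Hypothesis act_rel :
  forall u v t, rel u v -> V t -> foldr act t u = foldr act t v.

(** The action laws are stated on the invariant set [V], because on the pairs [(z, s)] used below
    inverse letters are shown to cancel for normal forms only. *)
Definition pres_act (g : presented rel) (t : T) : T := foldr act t (repr g).

Lemma word_act_stable w t : V t -> V (foldr act t w).
Proof. by move=> Vt; elim: w => //= l w; exact: act_stable. Qed.

Lemma word_act_pres_eq u v t :
  pres_eq rel u v -> V t -> foldr act t u = foldr act t v.
Proof.
move=> uv; elim: uv t => {u v} //=.
- by move=> u v _ IH t Vt; rewrite IH.
- by move=> u v w _ IH1 _ IH2 t Vt; rewrite IH1 ?IH2.
- move=> u u' v v' _ IH1 _ IH2 t Vt; rewrite !foldr_cat IH2 // IH1 //.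
  exact: word_act_stable.
- by move=> u v uv t Vt; exact: act_rel.
Qed.

Lemma pres_act_class w t : V t -> pres_act (pres_class rel w) t = foldr act t w.
Proof. exact/word_act_pres_eq/pres_repr. Qed.

Lemma pres_act_stable g t : V t -> V (pres_act g t).
Proof. exact: word_act_stable. Qed.

Lemma pres_actM g h t : V t -> pres_act (g * h)%g t = pres_act g (pres_act h t).
Proof.
move=> Vt; rewrite -[g]pres_classK -[h]pres_classK -pres_classM.
rewrite !pres_act_class ?foldr_cat //; exact: word_act_stable.
Qed.

Lemma pres_act1 t : V t -> pres_act 1%g t = t.
Proof. exact: (pres_act_class [::]). Qed.

End PresentedAction.

Lemma word_act_exp (X T : Type) (act : X * bool -> T -> T) (x : X)
    (shift : int -> T) :
  (forall k, act (x, false) (shift k) = shift (k + 1)) ->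
  (forall k, act (x, true) (shift k) = shift (k - 1)) ->
  forall j k, foldr act (shift k) (word_exp x j) = shift (k + j).
Proof.
move=> actp actn [i|i] k /=.
  by elim: i => [|i IHi] /=; rewrite ?addr0 // IHi actp; congr shift; lia.
rewrite -[act _ _]/(foldr act (shift k) (nseq i.+1 (x, true))) NegzE.
by elim: i.+1 => [|{}i IHi] /=; rewrite ?subr0 // IHi actn; congr shift; lia.
Qed.

(** * Cyclic words *)

Lemma cycle_flatten (T : eqType) (R : rel T) k s :
  cycle R s -> sorted R (flatten (nseq k s)).
Proof.
case: s => [_|x p /=]; first by elim: k.
rewrite rcons_path => /andP[xp px]; apply: (@path_sorted _ _ (last x p)).
by elim: k => //= k IHk; rewrite cat_path px xp.
Qed.

Lemma not_path_cat (T : Type) (R : rel T) x p :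
  ~~ path R x p ->
  exists p1 y z p2, x :: p = p1 ++ [:: y, z & p2] /\ ~~ R y z.
Proof.
elim: p x => //= y p IHp x; rewrite negb_and => /orP[nR|nyp].
  by exists [::], x, y, p.
by have [p1 [y' [z [p2 [-> nR]]]]] := IHp _ nyp; exists (x :: p1), y', z, p2.
Qed.

(** The failing pair may be the closing one, so a rotation brings it to the front. Reflexivity
    excludes one-letter words, whose closing pair is [(x, x)]. *)
Lemma not_cycle_cat (T : Type) (R : rel T) s :
  reflexive R -> ~~ cycle R s ->
  exists s1 s2 y z p, [/\ s = s1 ++ s2, s2 ++ s1 = [:: y, z & p] & ~~ R y z].
Proof.
case: s => // x p Rxx /=; rewrite rcons_path negb_and => /orP[nxp|].
  have [p1 [y [z [p2 [-> nR]]]]] := not_path_cat nxp.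
  by exists p1, [:: y, z & p2], y, z, (p2 ++ p1).
case/lastP: p => [|p y]; first by rewrite Rxx.
rewrite last_rcons => nR; exists (x :: p), [:: y], y, x, p.
by rewrite -cats1.
Qed.

Section BaumslagSolitar.
Variables m n : int.
Hypotheses (m_neq0 : m != 0) (n_neq0 : n != 0).

Local Notation a := (pres_gen (BS_rel m n) gen_a : BS m n).
Local Notation b := (pres_gen (BS_rel m n) gen_b : BS m n).

(** * The affine action and the height *)

Definition affine_ratio : rat := m%:~R / n%:~R.

Lemma affine_ratio_neq0 : affine_ratio != 0.
Proof. by rewrite mulf_neq0 ?invr_eq0 ?intr_eq0. Qed.

(** The second component counts the exponent sum of [a], so the height is well defined by the same
    argument as the affine map. *)
Definition affine_act (l : bool * bool) (t : rat * int) : rat * int :=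
  match l with
  | (true, e) => (t.1 + (if e then -1 else 1), t.2)
  | (false, false) => (affine_ratio * t.1, t.2 + 1)
  | (false, true) => (affine_ratio^-1 * t.1, t.2 - 1)
  end.

Lemma affine_act_cancel x e t : affine_act (x, e) (affine_act (x, ~~ e) t) = t.
Proof.
have s0 := affine_ratio_neq0.
case: t x e => [q k] [] [] /=; congr pair; rewrite ?mulKf ?mulVKf //;
  try lia; ring.
Qed.

Lemma affine_act_exp t j :
  foldr affine_act t (word_exp gen_b j) = (t.1 + j%:~R, t.2).
Proof.
pose shift k : rat * int := (t.1 + k%:~R, t.2).
have := @word_act_exp _ _ affine_act gen_b shift _ _ j 0; rewrite /shift /=.
rewrite addr0 add0r -surjective_pairing; apply => k /=.
  by rewrite rmorphD /= addrA.
by rewrite rmorphB /= addrA.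
Qed.

Lemma affine_act_rel u v t :
  BS_rel m n u v -> foldr affine_act t u = foldr affine_act t v.
Proof.
move=> [-> ->]; rewrite !foldr_cat !affine_act_exp /= addrK; congr pair.
rewrite mulrDr mulKf ?affine_ratio_neq0 // /affine_ratio invf_div.
by rewrite divfK ?intr_eq0.
Qed.

Definition aff : BS m n -> rat * int -> rat * int :=
  pres_act affine_act (rel := BS_rel m n).

Lemma aff_class w t : aff (pres_class _ w) t = foldr affine_act t w.
Proof.
apply: (@pres_act_class _ _ _ xpredT) => //.
  by move=> *; exact: affine_act_cancel.
by move=> *; exact: affine_act_rel.
Qed.

Lemma affM g h t : aff (g * h)%g t = aff g (aff h t).
Proof.
apply: (@pres_actM _ _ _ xpredT) => //.
  by move=> *; exact: affine_act_cancel.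
by move=> *; exact: affine_act_rel.
Qed.

Definition height (g : BS m n) : int := (aff g (0, 0)).2.

Lemma affE g t :
  aff g t = (affine_ratio ^ height g * t.1 + (aff g (0, 0)).1, t.2 + height g).
Proof.
rewrite -[g]pres_classK /height !aff_class.
have s_unit : affine_ratio \is a GRing.unit by rewrite unitfE affine_ratio_neq0.
elim: (repr g) => [|[[] e] w IHw] /=; rewrite ?IHw.
- by rewrite expr0z mul1r !addr0 -surjective_pairing.
- by rewrite /= addrA.
by case: e; rewrite /= addrA exprzDr ?exprN1 ?expr1z // mulrDr mulrA;
  rewrite [_ ^ _ * _]mulrC.
Qed.

Lemma heightM g h : height (g * h)%g = height g + height h.
Proof. by rewrite /height affM affE /= addrC. Qed.

Lemma height1 : height 1%g = 0.
Proof. by apply: (addrI (height 1%g)); rewrite -heightM mulg1 addr0. Qed.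

Lemma heightV g : height g^-1%g = - height g.
Proof. by apply/eqP; rewrite -addr_eq0 -heightM mulVg height1. Qed.

Lemma heightJ g h : height (g ^ h)%g = height g.
Proof. by rewrite conjgE !heightM heightV; lia. Qed.

Lemma height_a : height a = 1.
Proof. by rewrite /height aff_class /= add0r. Qed.

Lemma aff_expb j t : aff (expgz b j) t = (t.1 + j%:~R, t.2).
Proof. by rewrite -pres_class_exp aff_class affine_act_exp. Qed.

Lemma height_expb j : height (expgz b j) = 0.
Proof. by rewrite /height aff_expb. Qed.

Lemma height_b : height b = 0.
Proof. exact: (height_expb 1). Qed.

(** Evaluate [b^i w = w b^j] at the origin: the translation part of [w] cancels, and its slope is
    [affine_ratio ^ height w]. *)
Lemma height_conj_expb w i j :
  (expgz b i ^ w)%g = expgz b j -> i%:~R = affine_ratio ^ height w * j%:~R.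
Proof.
move=> biw; have := erefl (aff (expgz b i * w)%g (0, 0)).
rewrite {2}conjgC biw !affM !aff_expb [in RHS]affE /= add0r => -[].
by rewrite addrC => /addIr.
Qed.

Hypothesis mn_neq : `|m| != `|n|.

(** The absolute value removes the sign of the ratio, and a positive number other than 1 has
    distinct integer powers. *)
Lemma affine_ratio_expI k : affine_ratio ^ k = affine_ratio -> k = 1.
Proof.
move=> sk; apply: (@ieexprIz _ `|affine_ratio|).
- by rewrite normr_gt0 affine_ratio_neq0.
- apply: contra mn_neq; rewrite /affine_ratio normf_div => /eqP h.
  have : `|m%:~R| = `|n%:~R| :> rat.
    rewrite -[LHS](divfK (_ : `|n%:~R| != 0)) ?h ?mul1r //.
    by rewrite normr_eq0 intr_eq0.
  by rewrite -!intr_norm => /intr_inj ->.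
- by rewrite -[in RHS]sk; case: k {sk} => k; rewrite /exprz ?normfV normrX.
Qed.

(** Undoing the conjugation by [v] leaves a relation between [b^(jm)] and [b^(jn)] through a
    conjugate of [w], which has the height of [w]. *)
Lemma height_of_relation w v j :
  j != 0 -> (expgz (expgz b j ^ v) m ^ w)%g = expgz (expgz b j ^ v)%g n ->
  height w = 1.
Proof.
move=> j0; rewrite -!expgzJ -!expgzM => /(congr1 (fun g => g ^ v^-1)%g).
rewrite conjgK -!conjgM => /height_conj_expb.
rewrite ?mulgA !heightM heightV addrAC subrr add0r => E.
apply: affine_ratio_expI.
move: E; rewrite !rmorphM /= mulrCA => /mulfI E.
by rewrite [RHS]/affine_ratio E ?mulfK ?intr_eq0.
Qed.

(** * The action on normal forms *)

(* a b^n = b^m a and a^-1 b^m = b^n a^-1: the powers of b that can be moved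
   leftwards across a^-1 (e = true), resp. across a (e = false). *)
Definition edge (e : bool) : int := if e then m else n.

Lemma edge_neq0 e : edge e != 0.
Proof. by case: e. Qed.

(* The syllable (e, c) stands for a^(+-1) b^c, with a^-1 when e holds. *)
Definition syllable : Type := (bool * int)%type.
Implicit Types (s : seq syllable) (e : bool).

Definition reduced_pair (x y : syllable) : bool :=
  (y.1 == ~~ x.1) ==> ~~ (edge x.1 %| x.2)%Z.

(* (z, s) stands for b^z times the product of the syllables in s; it is a normal
   form when s is reduced and the exponents in s are least remainders. *)
Definition normal (t : int * seq syllable) : Prop :=
  all (fun x => (x.2 %% edge x.1)%Z == x.2) t.2 /\ sorted reduced_pair t.2.

(** The multiple of [edge e] in [z] crosses the new letter to the left; the remainder stays behind
    as its exponent. *)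
Definition nf_push e (z : int) s : int * seq syllable :=
  ((z %/ edge e)%Z * edge (~~ e), (e, (z %% edge e)%Z) :: s).

Definition nf_mula e (t : int * seq syllable) : int * seq syllable :=
  match t.2 with
  | (e', c) :: s =>
      if (e' == ~~ e) && (edge e %| t.1)%Z
      then ((t.1 %/ edge e)%Z * edge (~~ e) + c, s) else nf_push e t.1 t.2
  | [::] => nf_push e t.1 t.2
  end.

Definition nf_act (l : bool * bool) (t : int * seq syllable) :=
  match l with
  | (true, e) => (t.1 + (if e then -1 else 1), t.2)
  | (false, e) => nf_mula e t
  end.

(** Being reduced depends on [z] only modulo [edge e], so it can be tested before taking the
    remainder. *)
Lemma nf_push_normal e z s :
  normal (z, s) -> (if s is x :: _ then reduced_pair (e, z) x else true) ->
  normal (nf_push e z s).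
Proof.
move=> [/= rng red] ok; split; first by rewrite /= rng modz_mod eqxx.
case: s red ok {rng} => //= x s -> ok; rewrite andbT; move: ok.
by rewrite /reduced_pair /= {1}(divz_eq z (edge e)) rpredDl ?dvdz_mull ?dvdzz.
Qed.

Lemma nf_act_stable l t : normal t -> normal (nf_act l t).
Proof.
case: l t => [[] e] [z s] //= nzs; rewrite /nf_mula /=.
case: s nzs => [|[e' c] s] nzs; first exact: nf_push_normal.
case: ifPn => [/andP[_ _]|bad].
  by move: nzs => [/= /andP[_ rng] /path_sorted].
by apply: nf_push_normal => //; rewrite /reduced_pair /= implybE -negb_and.
Qed.

Lemma nf_act_cancel x e t : normal t -> nf_act (x, e) (nf_act (x, ~~ e) t) = t.
Proof.
case: t x => [z s] [] nzs /=.
  by congr pair; case: e => /=; lia.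
have pushK : nf_mula e (nf_push (~~ e) z s) = (z, s).
  rewrite /nf_mula /nf_push /= eqxx negbK dvdz_mull ?dvdzz //=.
  by rewrite mulzK ?edge_neq0 // -divz_eq.
rewrite {2}/nf_mula /=; case: s nzs pushK => [//|[e' c] s] nzs pushK.
case: ifPn => [/andP[/eqP e'E dz]|//]; rewrite {}e'E !negbK in nzs *.
move: nzs => [/= /andP[/eqP rc _] red].
(* The inner letter has removed the syllable [(e, c)]. As [c] is a least remainder, pushing [e]
   again restores exactly this syllable. *)
have c_small : (c %/ edge e)%Z = 0.
  have := divz_eq c (edge e); rewrite rc.
  move/eqP; rewrite eq_sym -subr_eq0 addrK mulf_eq0 (negPf (edge_neq0 e)).
  by rewrite orbF => /eqP.
have qE :
    (((z %/ edge (~~ e))%Z * edge e + c) %/ edge e)%Z = (z %/ edge (~~ e))%Z.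
  by rewrite divzMDl ?edge_neq0 // c_small addr0.
have zE : (z %/ edge (~~ e))%Z * edge (~~ e) = z by rewrite divzK.
have pushE : nf_push e ((z %/ edge (~~ e))%Z * edge e + c) s = (z, (e, c) :: s).
  by rewrite /nf_push qE zE modzMDl rc.
rewrite /nf_mula /=.
case: s red {pushK} pushE => [//|[e1 c1] s] /= /andP[red _] pushE.
case: ifPn => // /andP[/eqP e1E]; rewrite rpredDl ?dvdz_mull ?dvdzz // => dc.
(* A cancellation with the next syllable instead would contradict reducedness of the original
   pair. *)
by move: red; rewrite /reduced_pair /= e1E eqxx /= dc.
Qed.

Lemma nf_act_exp t j : foldr nf_act t (word_exp gen_b j) = (t.1 + j, t.2).
Proof.
have /= := @word_act_exp _ _ nf_act gen_b (fun k => (t.1 + k, t.2)) _ _ j 0.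
by rewrite addr0 add0r -surjective_pairing; apply => k /=; rewrite addrA.
Qed.

(** The defining relation as a commutation rule; with [q = 1] it reduces the relator to a
    cancellation of [a^-1] with [a]. *)
Lemma nf_mula_shift e q t :
  nf_mula e (t.1 + q * edge e, t.2) =
  ((nf_mula e t).1 + q * edge (~~ e), (nf_mula e t).2).
Proof.
case: t => [z s]; rewrite /nf_mula /nf_push /=.
rewrite [z + _]addrC divzMDl ?edge_neq0 // modzMDl rpredDl ?dvdz_mull ?dvdzz //.
by case: s => [|[e' c] s]; last case: ifP => _; congr pair => /=; ring.
Qed.

Lemma nf_act_rel u v t :
  BS_rel m n u v -> normal t -> foldr nf_act t u = foldr nf_act t v.
Proof.
move=> [-> ->] nt; rewrite !foldr_cat !nf_act_exp /=.
rewrite -[m in _ + m]mul1r -(nf_mula_shift false 1 t) mul1r.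
exact: (nf_act_cancel false true).
Qed.

Definition nf : BS m n -> int * seq syllable -> int * seq syllable :=
  pres_act nf_act (rel := BS_rel m n).

Lemma nf_class w t : normal t -> nf (pres_class _ w) t = foldr nf_act t w.
Proof.
exact: (pres_act_class nf_act_stable nf_act_cancel nf_act_rel).
Qed.

Lemma nfM g h t : normal t -> nf (g * h)%g t = nf g (nf h t).
Proof. exact: (pres_actM nf_act_stable nf_act_cancel nf_act_rel). Qed.

Lemma nf1 t : normal t -> nf 1%g t = t.
Proof. exact: (pres_act1 nf_act_stable nf_act_cancel nf_act_rel). Qed.

Lemma nf_normal g t : normal t -> normal (nf g t).
Proof. exact: (pres_act_stable nf_act_stable). Qed.

Lemma normal_nil z : normal (z, [::]).
Proof. by []. Qed.

(** * Syllable products and the length of normal forms *)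

Definition stable_letter e : BS m n := pres_class _ [:: (gen_a, e)].

Lemma stable_letterV e : stable_letter (~~ e) = (stable_letter e)^-1%g.
Proof. by rewrite -pres_classV. Qed.

Lemma nf_stable_letter e t : normal t -> nf (stable_letter e) t = nf_mula e t.
Proof. by move=> nt; rewrite nf_class. Qed.

Lemma nf_expb j t : normal t -> nf (expgz b j) t = (t.1 + j, t.2).
Proof. by move=> nt; rewrite -pres_class_exp nf_class ?nf_act_exp. Qed.

Definition syl (x : syllable) : BS m n :=
  (stable_letter x.1 * expgz b x.2)%g.

Definition syls s : BS m n := (\prod_(x <- s) syl x)%g.

Lemma syls_cons x s : syls (x :: s) = (syl x * syls s)%g.
Proof. exact: big_cons. Qed.

Lemma syls_cat s1 s2 : syls (s1 ++ s2) = (syls s1 * syls s2)%g.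
Proof. exact: big_cat. Qed.

Lemma syls_nseq k s : syls (flatten (nseq k s)) = (syls s ^+ k)%g.
Proof.
elim: k => [|k IHk] /=; first exact: big_nil.
by rewrite syls_cat IHk expgS.
Qed.

(* Britton's lemma. *)
Lemma nf_syls_reduced s (t := nf (syls s) (0, [::])) :
  sorted reduced_pair s ->
  [seq x.1 | x <- t.2] = [seq x.1 | x <- s] /\
  (if s is x :: _ then (edge (~~ x.1) %| t.1)%Z else true).
Proof.
rewrite {}/t; elim: s => [_|[e c] s IHs red].
  by rewrite /syls big_nil nf1.
have {IHs} [] := IHs (path_sorted red); rewrite syls_cons -mulgA.
have := nf_normal (syls s) (normal_nil 0).
rewrite !nfM //.
case: (nf (syls s) _) => z s' /= nzs' sgn div.
rewrite nf_expb // nf_stable_letter //= /nf_mula /=.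
have push : [seq x.1 | x <- (nf_push e (z + c) s').2] =
    e :: [seq x.1 | x <- s] /\
    (edge (~~ e) %| (nf_push e (z + c) s').1)%Z.
  by rewrite /= sgn dvdz_mull ?dvdzz.
case: s' s sgn red div push {nzs'} => [//|[e1 c1] s'] [//|[e2 c2] s] /=.
move=> [-> _] /andP[red _] div push.
(* Cancellation needs [edge e] to divide [z + c]; the invariant says that it divides [z], hence [c],
   against reducedness. *)
case: ifPn => // /andP[/eqP e2E]; rewrite e2E negbK in div.
rewrite rpredDl // => dc.
by move: red; rewrite /reduced_pair /= e2E eqxx dc.
Qed.

(** The bound counts syllables, whatever their exponents, so it compares with the exact length in
    [size_nf_cyclic]. *)
Lemma size_nf_syls s t :
  normal t -> (size (nf (syls s) t).2 <= size t.2 + size s)%N.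
Proof.
move=> nt; elim: s => [|[e c] s IHs]; first by rewrite /syls big_nil nf1 ?addn0.
rewrite syls_cons -mulgA !nfM //.
have := nf_normal (syls s) nt; case: (nf _ _) IHs => z s' /= szs nzs'.
rewrite nf_expb // nf_stable_letter // /nf_mula /=.
by case: s' szs {nzs'} => [|[e1 c1] s'] /= szs; last case: ifP => _ /=; lia.
Qed.

Lemma size_nf g t : (size (nf g t).2 <= size t.2 + size (repr g))%N.
Proof.
rewrite /nf /pres_act; elim: (repr g) => [|[[] e] w] /=; rewrite ?addn0 //.
  lia.
case: (foldr _ _ _) => z [|[e1 c1] s'] /= szs; rewrite /nf_mula /=; first lia.
by case: ifP => _ /=; lia.
Qed.

Lemma size_nf_cyclic k s :
  cycle reduced_pair s ->
  size (nf (syls s ^+ k)%g (0, [::])).2 = (k * size s)%N.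
Proof.
move=> /(cycle_flatten k) /nf_syls_reduced [+ _]; rewrite syls_nseq.
move=> /(congr1 size); rewrite !size_map => ->.
by elim: k => //= k IHk; rewrite size_cat IHk mulSn.
Qed.

Lemma conj_cyclic_powers_le s k l u :
  s != [::] -> cycle reduced_pair s ->
  ((syls s ^+ k) ^ u)%g = (syls s ^+ l)%g -> (k <= l)%N.
Proof.
move=> s0 cs kl; rewrite leqNgt; apply/negP => lk.
(* [C] bounds the total length change due to [u] and its inverse. If [l < k], multiplying both
   exponents by [C + 1] makes the lengths differ by more than [C]. *)
set C := (size (repr u) + size (repr u^-1%g))%N.
have n0 := normal_nil 0.
have E : (u^-1 * syls s ^+ (k * C.+1) = syls s ^+ (l * C.+1) * u^-1)%g.
  by rewrite [in RHS]expgnA -kl -conjXg -expgnA conjgE !mulgA mulgK.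
have /(congr1 (fun g => size (nf g (0, [::])).2)) := E.
rewrite !nfM // => szE.
have := size_nf u (nf u^-1%g (nf (syls s ^+ (k * C.+1))%g (0, [::]))).
rewrite -nfM ?mulgV ?nf1; do ?exact: nf_normal.
rewrite size_nf_cyclic // szE.
have := size_nf_syls (flatten (nseq (l * C.+1) s)) (nf_normal u^-1%g n0).
rewrite syls_nseq.
have -> : size (flatten (nseq (l * C.+1) s)) = (l * C.+1 * size s)%N.
  by elim: (_ * _)%N => //= i IHi; rewrite size_cat IHi mulSn.
have := size_nf u^-1%g (0, [::]); rewrite /= add0n.
have : (C.+1 * size s + l * C.+1 * size s <= k * C.+1 * size s)%N.
  by rewrite -mulnDl -mulSn !leq_mul2r lk !orbT.
have : (C.+1 <= C.+1 * size s)%N by rewrite leq_pmulr // lt0n size_eq0.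
(* Products are abstracted into variables to leave linear arithmetic. *)
have absurd (c1 c2 x y z t w : nat) : (c1 + c2 < x -> x + y <= z ->
    t <= c2 -> w <= t + y -> z <= w + c1 -> False)%N by lia.
exact: absurd.
Qed.

Lemma conj_cyclic_powers s k l u :
  s != [::] -> cycle reduced_pair s ->
  ((syls s ^+ k) ^ u)%g = (syls s ^+ l)%g -> k = l.
Proof.
move=> s0 cs kl; apply/eqP; rewrite eqn_leq (conj_cyclic_powers_le s0 cs kl).
by apply: (@conj_cyclic_powers_le s l k u^-1%g) => //; rewrite -kl conjgK.
Qed.

(** * Conjugation to a power of [b] or a cyclically reduced word *)

Lemma stable_letter_expb e q :
  (stable_letter e * expgz b (q * edge e) =
   expgz b (q * edge (~~ e)) * stable_letter e)%g.
Proof.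
have rel_q : (a^-1 * expgz b (q * m) * a = expgz b (q * n))%g.
  have := BS_relation m n; rewrite /= -mulgA -conjgE => rel1.
  by rewrite -mulgA -conjgE ![q * _]mulrC !expgzM -rel1 expgzJ.
case: e; rewrite /edge /=; last by rewrite -rel_q !mulgA mulgV mul1g.
rewrite -rel_q.
have -> : stable_letter true = a^-1%g by exact: (stable_letterV false).
by rewrite mulgK.
Qed.

(** Induction on the number of syllables: a cyclic word that is not reduced is rotated until a bad
    pair comes first, and cancelling that pair removes two syllables. *)
Lemma conj_syls_or_expb g :
  exists v, (exists j, (g ^ v)%g = expgz b j) \/
    (exists s, [/\ s != [::], cycle reduced_pair s & (g ^ v)%g = syls s]).
Proof.
pose P h := exists v, (exists j, (h ^ v)%g = expgz b j) \/
    (exists s, [/\ s != [::], cycle reduced_pair s & (h ^ v)%g = syls s]).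
have PJ u h : P (h ^ u)%g -> P h.
  by move=> [v Pv]; exists (u * v)%g; rewrite conjgM.
have conjMC (h k : BS m n) : ((h * k) ^ h = k * h)%g.
  by rewrite conjgE mulgA mulKg.
have Psyls k s z : (size s <= k)%N -> P (syls s * expgz b z)%g.
  elim: k s z => [|k IHk] s z.
    rewrite leqn0 size_eq0 => /eqP->; exists 1%g; left; exists z.
    by rewrite /syls big_nil mul1g conjg1.
  case/lastP: s => [_|s [e c]]; first exact: (IHk [::]).
  (* A trailing power of [b] is absorbed into the last syllable. *)
  have -> : (syls (rcons s (e, c)) * expgz b z)%g = syls (rcons s (e, c + z)).
    by rewrite -!cats1 !syls_cat /syls !big_seq1 /syl /= expgzD !mulgA.
  have : rcons s (e, c + z) != [::] by rewrite -size_eq0 size_rcons.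
  have : size (rcons s (e, c + z)) = size (rcons s (e, c)).
    by rewrite !size_rcons.
  move: (rcons s _) (rcons s (e, c)) => s2 s1 <- {s1 s e c z} s0 szs.
  have [cs|] := boolP (cycle reduced_pair s2).
    by exists 1%g; right; exists s2; rewrite conjg1.
  have rxx : reflexive reduced_pair by case=> -[] c.
  move=> /(not_cycle_cat rxx) [p1 [p2 [[e c] [[e' c'] [p []]]]]].
  move=> s2E rotE; rewrite /reduced_pair /= negb_imply negbK.
  move=> /andP[/eqP e'E /dvdzP[q cE]].
  apply: (PJ (syls p1)); rewrite s2E syls_cat conjMC -syls_cat rotE !syls_cons.
  have -> : (syl (e, c) * (syl (e', c') * syls p))%g =
      (expgz b (q * edge (~~ e) + c') * syls p)%g.
    rewrite /syl /= cE e'E stable_letter_expb stable_letterV expgzD !mulgA.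
    by rewrite mulgK.
  (* Conjugation moves the leftover power of [b] to the end, the form required by the induction
     hypothesis. *)
  apply: (PJ (expgz b (q * edge (~~ e) + c'))); rewrite conjMC.
  apply: IHk; have := congr1 size rotE; move: szs.
  by rewrite s2E !size_cat /=; lia.
suff [s [z [k ->]]] : exists s z k, (g = (syls s * expgz b z) ^ k)%g.
  by apply: (PJ k^-1%g); rewrite conjgK; exact: (Psyls _ _ _ (leqnn _)).
suff [z [s ->]] : exists z s, g = (expgz b z * syls s)%g.
  by exists s, z, (expgz b z)^-1%g; rewrite -[(syls s * _)%g]conjMC conjgK.
rewrite -[g]pres_classK; elim: (repr g) => [|[[] e] w [z [s IHw]]].
- by exists 0, [::]; rewrite /syls big_nil mulg1.
- exists ((if e then -1 else 1) + z), s.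
  rewrite -cat1s pres_classM IHw expgzD mulgA; congr (_ * _ * _)%g.
  by rewrite -pres_class_exp; case: e.
- exists 0, ((e, z) :: s).
  by rewrite -cat1s pres_classM IHw mul1g syls_cons /syl mulgA.
Qed.

(** * Injective endomorphisms preserve the height *)

Lemma conj_expb_of_relation (x u : BS m n) :
  x != 1%g -> (expgz x m ^ u)%g = expgz x n ->
  exists v j, j != 0 /\ x = (expgz b j ^ v)%g.
Proof.
move=> x1 rel_x; have [v [[j xj]|[s [s0 cs xs]]]] := conj_syls_or_expb x.
  exists v^-1%g, j; split; last by rewrite -xj conjgK.
  by apply: contra x1 => /eqP j0; rewrite -(conjg_eq1 x v) xj j0.
pose w := (u ^ v)%g.
have rel_s : (expgz (syls s) m ^ w)%g = expgz (syls s) n.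
  by rewrite -xs -!expgzJ -conjJg rel_x.
(* Applying the relation twice gives the exponents [m * m] and [n * n], which are natural numbers
   whatever the signs. *)
have sq k : k * k = (`|k| * `|k|)%N by lia.
have : ((syls s ^+ (`|m| * `|m|)) ^ (w * w) = syls s ^+ (`|n| * `|n|))%g.
  rewrite -[LHS]/(expgz (syls s) (`|m| * `|m|)%N ^ _)%g.
  rewrite -[RHS]/(expgz (syls s) (`|n| * `|n|)%N) -!sq.
  have step k : (expgz (syls s) (m * k) ^ w)%g = expgz (syls s) (n * k).
    by rewrite !expgzM expgzJ rel_s.
  by rewrite conjgM step mulrC step.
move=> /(conj_cyclic_powers s0 cs) /eqP; rewrite !mulnn eqn_exp2r // => /eqP E.
by case/eqP: mn_neq; lia.
Qed.

(** Injectivity enters through [phi b != 1]; the heights of [phi a] and [phi b] then determine that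
    of every word. *)
Lemma height_injective (phi : UMagmaMorphism.type (BS m n) (BS m n)) :
  injective phi -> forall g, height (phi g) = height g.
Proof.
move=> phi_inj.
have b1 : b != 1%g.
  apply/eqP => /(congr1 (fun g => (aff g (0, 0)).1)).
  by rewrite !aff_class /= add0r.
have rel_phi : (expgz (phi b) m ^ phi a)%g = expgz (phi b) n.
  rewrite -!gmulfXz -gmulfJ; congr (phi _).
  by rewrite conjgE mulgA; exact: BS_relation.
have phib1 : phi b != 1%g by rewrite (gmulf_eq1 _ phi_inj).
have [v [j [j0 phib]]] := conj_expb_of_relation phib1 rel_phi.
have phia : height (phi a) = 1.
  by apply: (@height_of_relation _ v j) => //; rewrite -phib.
have {}phib : height (phi b) = 0 by rewrite phib heightJ height_expb.
move=> g; rewrite -[g]pres_classK; elim: (repr g) => [|[x e] w IHw].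
  by rewrite gmulf1.
rewrite -cat1s pres_classM gmulfM !heightM IHw; congr (_ + _).
have gen y : height (phi (pres_gen _ y)) = height (pres_gen _ y).
  by case: y; rewrite ?phia ?phib ?height_a ?height_b.
case: e; last exact: gen.
have -> : pres_class _ [:: (x, true)] = (pres_gen (BS_rel m n) x)^-1%g.
  by rewrite -pres_classV.
by rewrite gmulfV !heightV gen.
Qed.

End BaumslagSolitar.

Theorem theorem7p1 (m n : int) (m_neq0 : m <> 0) (n_neq0 : n <> 0)
    (mn_neq : `|m| <> `|n|)
    (phi psi : UMagmaMorphism.type (BS m n) (BS m n))
    (phi_inj : injective phi) (psi_inj : injective psi) :
  infinite_set (reidemeister_classes phi psi).
Proof.
have m0 : m != 0 by apply/eqP.
have n0 : n != 0 by apply/eqP.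
have mn : `|m| != `|n| by apply/eqP.
pose a : BS m n := pres_gen _ gen_a.
have height_class alpha beta :
    reidemeister_rel phi psi alpha beta -> height beta = height alpha.
  move=> [tau ->]; rewrite !heightM // heightV // !height_injective //; lia.
have height_aX i : height (a ^+ i)%g = i.
  elim: i => [|i IHi]; first exact: height1.
  by rewrite expgS heightM // height_a // IHi; lia.
pose f i := reidemeister_class phi psi (a ^+ i)%g.
have f_inj : injective f.
  move=> i j fij.
  have : f i (a ^+ j)%g by rewrite fij; exact: reidemeister_rel_refl.
  by move=> /height_class; rewrite !height_aX => -[].
(* The classes of the powers of [a] embed the natural numbers, so finitely many classes would make
   these finite. *)
move=> fin; apply: infinite_nat.
have := finite_preimage (f := f) (in2W f_inj) fin.
by congr finite_set; apply/seteqP; split=> // i _; exists (a ^+ i)%g.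
Qed.
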